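(* Let $T:\ell^\infty(\mathbb{N})\to\ell^\infty(\mathbb{N})$ be the right-shift operator $T(x_0,x_1,x_2,\ldots)=(0,x_0,x_1,x_2,\ldots)$. Let $(\pi^n)_{n\in\mathbb{N}}$ be an arbitrary sequence with $\pi^n_i\ge0$, $\sum_{i=0}^n\pi^n_i=1$ and $\pi^n_i=0$ for $i>n$, and consider the general Mann iteration $$x^n=\sum_{i=0}^n\pi^n_i\,Tx^{i-1}\qquad(n\ge1),$$ with the convention $Tx^{-1}=y^0$, started from $x^0=y^0=(1,1,1,\ldots)$. Then the iterates satisfy $$\|x^n-Tx^n\|_\infty\ \ge\ \frac{1}{n+1}.$$
   Context: $\mathbb{N}=\{0,1,2,\ldots\}$ and $\ell^\infty(\mathbb{N})$ is the space of bounded real sequences with the sup norm $\|\cdot\|_\infty$. ''$Tx^{-1}$'' is only a notation for the point $y^0$. *)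

(* Defs.v *)
From HB Require Import structures.
From mathcomp Require Import all_boot all_order all_algebra.
From mathcomp Require Import all_classical all_reals all_analysis.

Set Implicit Arguments.
Unset Strict Implicit.
Unset Printing Implicit Defensive.

Import Order.TTheory GRing.Theory Num.Theory.
Import numFieldNormedType.Exports.

Local Open Scope classical_set_scope.
Local Open Scope ring_scope.

Section linfty.
Variable R : realType.

Definition bounded_seq : {pred nat -> R} :=
  mem (bounded_fun : set (nat -> R)).

Lemma bounded_seqP (u : nat -> R) :
  reflect (exists M, forall i, `|u i| <= M) (u \in bounded_seq).
Proof.
have PF : ProperFilter (globally [set: nat])
  by exact: (globally_properfilter (a := 0%N)).
apply: (iffP idP) => [/set_mem uB|[M uM]].
  have [M uM] := (ex_bound u).1 uB.
  by exists M => i; exact: uM.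
by apply/mem_set/(ex_bound u); exists M => i _; exact: uM.
Qed.

Lemma bounded_seq_submod_closed : submod_closed bounded_seq.
Proof.
split; first by apply/bounded_seqP; exists 0 => i; rewrite normr0.
move=> a u v /bounded_seqP[M uM] /bounded_seqP[N vN].
apply/bounded_seqP; exists (`|a| * M + N) => i.
rewrite (le_trans (ler_normD _ _))// lerD//.
by rewrite normrM ler_wpM2l.
Qed.

HB.instance Definition _ :=
  GRing.isSubmodClosed.Build R (nat -> R) bounded_seq bounded_seq_submod_closed.

Record linfty : Type := Linfty {
  linfty_val :> nat -> R;
  linfty_valP : linfty_val \in bounded_seq }.

HB.instance Definition _ := [isSub for linfty_val].
HB.instance Definition _ := [Choice of linfty by <:].
HB.instance Definition _ := [SubChoice_isSubLmodule of linfty by <:].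

Implicit Types x y : linfty.

Definition linfty_norm x : R := sup (range (fun i => `|x i|)).

Lemma linfty_has_sup x : has_sup (range (fun i => `|x i|)).
Proof.
split; first by exists `|x 0%N|, 0%N.
have /bounded_seqP[M xM] := linfty_valP x.
by exists M => _ [i _ <-].
Qed.

Lemma linfty_norm_ub x i : `|x i| <= linfty_norm x.
Proof. by apply: ub_le_sup; [case: (linfty_has_sup x)|exists i]. Qed.

Lemma linfty_norm_le x M : (forall i, `|x i| <= M) -> linfty_norm x <= M.
Proof.
move=> xM; apply: ge_sup; first by case: (linfty_has_sup x).
by move=> _ [i _ <-].
Qed.

Lemma linfty_ler_normD x y :
  linfty_norm (x + y) <= linfty_norm x + linfty_norm y.
Proof.
apply: linfty_norm_le => i; rewrite (le_trans (ler_normD _ _))//.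
by rewrite lerD// linfty_norm_ub.
Qed.

Lemma linfty_normrZ (a : R) x : linfty_norm (a *: x) = `|a| * linfty_norm x.
Proof.
apply/eqP; rewrite eq_le; apply/andP; split.
  apply: linfty_norm_le => i.
  by rewrite normrM ler_wpM2l// linfty_norm_ub.
have [->|a0] := eqVneq a 0.
  rewrite normr0 mul0r.
  exact: le_trans (normr_ge0 _) (linfty_norm_ub (0 *: x) 0%N).
rewrite mulrC -ler_pdivlMr ?normr_gt0//; apply: linfty_norm_le => i.
rewrite ler_pdivlMr ?normr_gt0// mulrC -normrM.
exact: (linfty_norm_ub (a *: x) i).
Qed.

Lemma linfty_normr0_eq0 x : linfty_norm x = 0 -> x = 0.
Proof.
move=> x0; apply/val_inj/funext => i /=.
by apply/eqP; rewrite -normr_le0 -x0 linfty_norm_ub.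
Qed.

HB.instance Definition _ := Lmodule_isNormed.Build R linfty
  linfty_ler_normD linfty_normrZ linfty_normr0_eq0.

Lemma linfty_normE x : `|x| = sup (range (fun i => `|x i|)).
Proof. by []. Qed.

Lemma ones_subproof : (fun _ : nat => 1 : R) \in bounded_seq.
Proof. by apply/bounded_seqP; exists 1 => i; rewrite normr1. Qed.

Definition ones : linfty := Linfty ones_subproof.

Lemma right_shift_subproof x :
  (fun k : nat => if k is j.+1 then x j else 0) \in bounded_seq.
Proof.
apply/bounded_seqP; exists `|x| => -[|j].
  by rewrite normr0 normr_ge0.
exact: linfty_norm_ub.
Qed.

Definition right_shift x : linfty := Linfty (right_shift_subproof x).

End linfty.

Section mann.
Variables (R : realType) (V : lmodType R).

(* T x^(i-1), where "T x^(-1)" denotes the point y0 *)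
Definition Tprev (T : V -> V) (y0 : V) (x : nat -> V) (i : nat) : V :=
  if i is j.+1 then T (x j) else y0.

Definition mann_weights (p : nat -> nat -> R) : Prop :=
  [/\ forall n i, 0 <= p n i,
      forall n, \sum_(0 <= i < n.+1) p n i = 1
    & forall n i, (n < i)%N -> p n i = 0].

Definition mann_iteration (T : V -> V) (p : nat -> nat -> R) (y0 : V)
    (x : nat -> V) : Prop :=
  x 0%N = y0 /\
  forall n, (1 <= n)%N ->
    x n = \sum_(0 <= i < n.+1) p n i *: Tprev T y0 x i.

End mann.

(* Main.v *)
Require Import Defs.
From mathcomp Require Import all_boot all_order all_algebra.
From mathcomp Require Import all_classical all_reals all_analysis.

Import Order.TTheory GRing.Theory Num.Theory.
Import numFieldNormedType.Exports.

Local Open Scope ring_scope.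

(** Each iteration applies the shift once more, and the zero that the shift
    inserts at the front travels by one coordinate per iteration; averaging
    does not speed it up.  So the [n]-th iterate still carries the initial
    value 1 in all coordinates [k >= n] ([mann_shift_tail]).  On the other hand
    the coordinates of [u - T u] are the increments of [u], started from 0: the
    first [n + 1] of them telescope to [u n], whence
    [u n <= (n + 1) * `|u - T u|] ([le_coord_shift_residual]).  For [u = x n],
    where [u n = 1], this is the bound. *)

Lemma linfty_sumE (R : realType) (m n : nat) (F : nat -> linfty R) (k : nat) :
  (\sum_(m <= i < n) F i) k = \sum_(m <= i < n) F i k.
Proof. exact: (big_morph (fun u : linfty R => u k)). Qed.

Lemma linfty_scaleE (R : realType) (a : R) (u : linfty R) (k : nat) :
  (a *: u) k = a * u k.
Proof. by []. Qed.

(** At a coordinate [k >= n] all the points averaged in [x n] take the value 1,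
    and the weights sum to 1. *)
Lemma mann_shift_tail (R : realType) (p : nat -> nat -> R)
    (x : nat -> linfty R) :
  (forall n, \sum_(0 <= i < n.+1) p n i = 1) ->
  mann_iteration (@right_shift R) p (ones R) x ->
  forall n k : nat, (n <= k)%N -> x n k = 1.
Proof.
move=> p1 [x0 xS]; elim/ltn_ind => -[|n] IH k nk; first by rewrite x0.
rewrite xS// linfty_sumE -[RHS](p1 n.+1).
apply: eq_big_nat => i /andP[_ i_le].
(* For i = j + 1 this value is x j (k - 1), and j <= k - 1 since
   j < n + 1 <= k. *)
suff Tx1 : Tprev (@right_shift R) (ones R) x i k = 1.
  by rewrite linfty_scaleE Tx1 mulr1.
case: i i_le => [//|j] j_lt; case: k nk => [//|k] nk.
exact: (IH j j_lt k (leq_trans (j_lt : (j <= n)%N) nk)).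
Qed.

(** The first term is [u 0 - 0]: the shift inserts a zero, so the telescoping
    sum loses nothing at its lower end. *)
Lemma sum_shift_residual (R : realType) (u : linfty R) (n : nat) :
  \sum_(0 <= k < n.+1) (u - right_shift u) k = u n.
Proof.
elim: n => [|n IH]; first by rewrite big_nat1 -[LHS]/(u 0%N - 0) subr0.
by rewrite big_nat_recr//= IH -[X in _ + X]/(u n.+1 - u n) addrC subrK.
Qed.

Lemma le_coord_shift_residual (R : realType) (u : linfty R) (n : nat) :
  u n <= n.+1%:R * `|u - right_shift u|.
Proof.
rewrite -[leLHS]sum_shift_residual.
have -> : n.+1%:R * `|u - right_shift u| =
    \sum_(0 <= k < n.+1) `|u - right_shift u|.
  by rewrite sumr_const_nat subn0 mulr_natl.
apply: ler_sum => k _; apply: le_trans (ler_norm _) _.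
exact: linfty_norm_ub.
Qed.

Theorem proposition3p1 (R : realType) (p : nat -> nat -> R)
    (x : nat -> linfty R) :
  mann_weights p ->
  mann_iteration (@right_shift R) p (ones R) x ->
  forall n : nat, `|x n - right_shift (x n)| >= 1 / (n.+1)%:R.
Proof.
move=> [_ p1 _] xM n.
have := le_coord_shift_residual _ (x n) n.
by rewrite (mann_shift_tail _ _ _ p1 xM _ _ (leqnn n)) ler_pdivrMr ?ltr0Sn// mulrC.
Qed.
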